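(* Let $0<\tau<\tfrac12$. Assume that, for given $\epsilon>0$ and $\mu>0$, there exists a fixed $\bar{\mathbf w}\in\mathbb R^n$ such that $\|\mathbf y_t-\bar{\mathbf w}\|_2\le\epsilon-\mu$ holds for all transactions $\mathbf y_1,\dots,\mathbf y_t,\dots$ presented. Let the step sizes of the algorithm FADO($\epsilon$) described in the context be $$\gamma_t=\frac{1}{m_t^{1/2+\tau}}\qquad\text{for all } t>0.$$ Then $$m_t = O\!\left(\left(\frac{\|\bar{\mathbf w}\|_2^2}{\mu}\right)^{\frac{2}{1-2\tau}}\right)<\infty\qquad\text{for all } t>0.$$
   Context: Algorithm FADO($\epsilon$), for fixed $\epsilon>0$ and step sizes $\gamma_t>0$. Transactions $\mathbf y_1,\mathbf y_2,\dots\in\mathbb R^n$ arrive one at a time. Initialise $\mathbf w_0=0\in\mathbb R^n$. At each time $t=1,2,\dots$: set $d_t=1$ (an alarm is raised, also called a mistake) if $\|\mathbf y_t-\mathbf w_{t-1}\|_2\ge\epsilon$, and $d_t=0$ otherwise. If $d_t=1$, set $\mathbf v_t=(\mathbf y_t-\mathbf w_{t-1})/\|\mathbf y_t-\mathbf w_{t-1}\|_2$ and update $\mathbf w_t=\mathbf w_{t-1}+\gamma_t\mathbf v_t$; if $d_t=0$, set $\mathbf w_t=\mathbf w_{t-1}$. The number of alarms up to time $t$ is $m_t=\sum_{s=1}^t d_s$ (so $m_t\ge1$ whenever $\gamma_t$ is used). The $O(\cdot)$ suppresses constants, described by the author as mild, which depend on $\sum_{s=1}^t d_s\gamma_s^2<\infty$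 and hence on the choice of the step sizes $\gamma_t$.
   Formalization: The constant in O(·) depends on τ and also on a positive lower bound for ‖w̄‖ when w̄≠0 (it is uniform in all else); a constant depending only on the step sizes is impossible: ‖w̄‖=μ=δ, y_t=(ε/δ)w̄ gives m_1=1 while the bound tends to 0 as δ→0. *)

(* Defs.v *)
From mathcomp Require Import all_boot all_order all_algebra.
From mathcomp Require Import reals exp.

Set Implicit Arguments.
Unset Strict Implicit.
Unset Printing Implicit Defensive.

Import Order.TTheory GRing.Theory Num.Theory.
Local Open Scope ring_scope.

(* The canonical norm on 'rV[R]_n in the analysis library is the sup norm,
   hence this separate Euclidean norm. *)
Definition norm2 (R : realType) (n : nat) (x : 'rV[R]_n) : R :=
  Num.sqrt (\sum_(i < n) x 0 i ^+ 2).

Definition fado_dir (R : realType) (n : nat) (y w : 'rV[R]_n) : 'rV[R]_n :=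
  (norm2 (y - w))^-1 *: (y - w).

(* Time starts at 1: the values y 0 and gamma 0 are never used. *)
Fixpoint fado_w (R : realType) (n : nat) (eps : R) (gamma : nat -> R)
    (y : nat -> 'rV[R]_n) (t : nat) : 'rV[R]_n :=
  if t is s.+1 then
    let w := fado_w eps gamma y s in
    if eps <= norm2 (y s.+1 - w) then w + gamma s.+1 *: fado_dir (y s.+1) w
    else w
  else 0.

(* Only meaningful for 0 < t. *)
Definition fado_d (R : realType) (n : nat) (eps : R) (gamma : nat -> R)
    (y : nat -> 'rV[R]_n) (t : nat) : bool :=
  eps <= norm2 (y t - fado_w eps gamma y t.-1).

Definition fado_m (R : realType) (n : nat) (eps : R) (gamma : nat -> R)
    (y : nat -> 'rV[R]_n) (t : nat) : nat :=
  (\sum_(1 <= s < t.+1) fado_d eps gamma y s)%N.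

(* Main.v *)
Require Import Defs.
From mathcomp Require Import all_boot all_order all_algebra.
From mathcomp Require Import reals exp.
From mathcomp Require Import sequences ring lra.

Import Order.TTheory GRing.Theory Num.Theory.
Local Open Scope ring_scope.

(* The potential |w_t - wbar|^2 drops by at least mu * gamma_t - gamma_t^2 at
   every alarm.  Summing over the m alarms, whose steps are k^-(1/2 + tau) for
   k = 1..m, gives
     mu * sum_(k <= m) k^-(1/2 + tau) <= |wbar|^2 + sum_(k <= m) k^-(1 + 2 tau).
   The left-hand sum is at least m * m^-(1/2 + tau), the right-hand one is
   bounded by S = 1 + 1/(2 tau), and S <= (S / r^2) |wbar|^2 when r <= |wbar|.
   If wbar = 0 the first alarm never occurs. *)

Section PowerSums.
Context {R : realType}.

(* With u = k + 2 the ratio is ((u - 1) / u)^-a >= 1 - a ln (1 - 1/u)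
   >= 1 + a / u. *)
Lemma powR_telescope (a : R) (k : nat) : 0 < a ->
  a * k.+2%:R `^ (- (1 + a)) <= k.+1%:R `^ (- a) - k.+2%:R `^ (- a).
Proof.
move=> a_gt0.
set u : R := k.+2%:R; have u_gt0 : 0 < u by rewrite ltr0n.
set b : R := 1 - u^-1.
have b_gt0 : 0 < b by rewrite subr_gt0 invf_lt1// ltr1n.
have -> : k.+1%:R = u * b :> R.
  by rewrite mulrBr mulr1 divff ?gt_eqF// /u -[k.+2%:R]natr1 addrK.
rewrite powRM ?(ltW u_gt0) ?(ltW b_gt0)// opprD powRD ?(gt_eqF u_gt0) ?implybT//.
rewrite powR_inv1 ?(ltW u_gt0)//.
have b_ge : 1 + a / u <= b `^ (- a).
  rewrite /powR (gt_eqF b_gt0); apply: le_trans (expR_ge1Dx _).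
  rewrite lerD2l mulNr -mulrN ler_pM2l// lerNr.
  by apply: le_ln1Dx; rewrite ltrN2 invf_lt1// ltr1n.
have := ler_wpM2l (powR_ge0 u (- a)) b_ge.
rewrite mulrDr mulr1 -lerBrDl => step; apply: le_trans step.
by rewrite mulrA [leRHS]mulrC.
Qed.

Lemma sum_powR_le (a : R) (m : nat) : 0 < a ->
  \sum_(k < m) k.+1%:R `^ (- (1 + a)) <= 1 + a^-1.
Proof.
move=> a_gt0.
have a_neq0 : a != 0 by rewrite gt_eqF.
case: m => [|m].
  by rewrite big_ord0 addr_ge0// invr_ge0 ltW.
(* The plain bound is not inductive; the subtracted term pays for each new summand through
   [powR_telescope]. *)
suff : \sum_(k < m.+1) k.+1%:R `^ (- (1 + a)) <=
    1 + a^-1 - a^-1 * m.+1%:R `^ (- a).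
  by move=> /le_trans; apply; rewrite gerBl mulr_ge0 ?powR_ge0// invr_ge0 ltW.
elim: m => [|m IHm].
  by rewrite big_ord_recr big_ord0 /= !powR1 add0r mulr1 addrK.
rewrite big_ord_recr /=.
have := powR_telescope a m a_gt0.
rewrite -(ler_pM2l (_ : 0 < a^-1)) ?invr_gt0// mulKf// mulrBr => step.
lra.
Qed.

Lemma sum_powR_ge (b : R) (m : nat) : 0 <= b -> (0 < m)%N ->
  m%:R `^ (1 - b) <= \sum_(k < m) k.+1%:R `^ (- b).
Proof.
move=> b_ge0 m_gt0.
(* Split [m^(1 - b)] as [m * m^-b], that is [m] copies of the smallest term, as [b >= 0]. *)
rewrite powRD; last by rewrite pnatr_eq0 -lt0n m_gt0 implybT.
rewrite powRr1 ?ler0n// mulrC.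
rewrite [X in X <= _](_ : _ = \sum_(k < m) m%:R `^ (- b)); last first.
  by rewrite sumr_const card_ord mulr_natr.
apply: ler_sum => k _; rewrite !powRN lef_pV2 ?posrE ?powR_gt0 ?ltr0n//.
by rewrite ge0_ler_powR ?nnegrE ?ler0n// ler_nat.
Qed.

End PowerSums.

Section Euclidean.
Context {R : realType} {n : nat}.
Implicit Types w x y : 'rV[R]_n.

Lemma sqr_norm2 x : norm2 x ^+ 2 = \sum_(i < n) x 0 i ^+ 2.
Proof. by rewrite sqr_sqrtr// sumr_ge0// => i _; rewrite sqr_ge0. Qed.

Lemma norm2_ge0 x : 0 <= norm2 x.
Proof. exact: sqrtr_ge0. Qed.

Lemma norm2N x : norm2 (- x) = norm2 x.
Proof. by congr Num.sqrt; apply: eq_bigr => i _; rewrite mxE sqrrN. Qed.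

(* Stewart's theorem. *)
Lemma sqr_norm2_affine (c : R) w x y :
  norm2 (w + c *: (y - w) - x) ^+ 2 =
  (1 - c) * norm2 (w - x) ^+ 2 + c * norm2 (y - x) ^+ 2
  - c * (1 - c) * norm2 (y - w) ^+ 2.
Proof.
rewrite !sqr_norm2 !mulr_sumr -sumrN -!big_split /=.
by apply: eq_bigr => i _; rewrite !mxE; ring.
Qed.

Lemma fado_step_le (eps mu g : R) w x y : 0 < eps -> 0 < mu -> 0 <= g ->
    norm2 (y - x) <= eps - mu -> eps <= norm2 (y - w) ->
  norm2 (w + g *: fado_dir y w - x) ^+ 2 + mu * g <=
  norm2 (w - x) ^+ 2 + g ^+ 2.
Proof.
(* Stewart's theorem with c = g / N turns the new squared distance into
   z^2 - c z^2 - c (N^2 - e^2) + g^2, and N^2 - e^2 >= mu N. *)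
move=> eps_gt0 mu_gt0 g_ge0 near far.
have N_gt0 : 0 < norm2 (y - w) by apply: lt_le_trans far.
rewrite /fado_dir scalerA sqr_norm2_affine.
have := norm2_ge0 (y - x).
set N := norm2 (y - w) in N_gt0 far *; set e := norm2 (y - x) in near *.
set z := norm2 (w - x) => e_ge0.
have [c c_ge0 ->] : exists2 c, 0 <= c & g = c * N.
  by exists (g / N); rewrite ?divfK ?gt_eqF// divr_ge0// ltW.
rewrite mulfK ?gt_eqF//.
(* Factor as [(N - e) (N + e)], where [N - e >= mu] and [N + e >= N]. *)
have gap : mu * N <= N ^+ 2 - e ^+ 2 by nra.
have cz_ge0 : 0 <= c * z ^+ 2 by rewrite mulr_ge0// sqr_ge0.
have := ler_wpM2l c_ge0 gap.
nra.
Qed.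

End Euclidean.

Section Fado.
Context {R : realType} {n : nat}.
Variables (eps mu tau : R) (wbar : 'rV[R]_n).
Variables (y : nat -> 'rV[R]_n) (gamma : nat -> R).
Hypotheses (eps_gt0 : 0 < eps) (mu_gt0 : 0 < mu).
Hypothesis near : forall t, (0 < t)%N -> norm2 (y t - wbar) <= eps - mu.

Local Notation w := (fado_w eps gamma y).
Local Notation m := (fado_m eps gamma y).

Lemma fado_mS t : m t.+1 = (m t + fado_d eps gamma y t.+1)%N.
Proof. by rewrite /fado_m big_nat_recr. Qed.

Lemma fado_m_center0 t : wbar = 0 -> m t = 0%N.
Proof.
move=> wbar0.
(* Both claims go together: while [w] is 0, every transaction lies within [eps - mu < eps] of it, so
   no alarm moves it. *)
suff [] : w t = 0 /\ m t = 0%N by [].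
elim: t => [|t [wt mt]]; first by rewrite /fado_m big_geq.
have quiet : (eps <= norm2 (y t.+1)) = false.
  apply/negbTE; rewrite -ltNge.
  have := near _ (ltn0Sn t); rewrite wbar0 subr0 => /le_lt_trans; apply.
  by rewrite gtrBl.
by rewrite fado_mS /fado_d /= wt mt subr0 quiet.
Qed.

Hypothesis gammaE : forall t, (0 < t)%N -> (0 < m t)%N ->
  gamma t = 1 / (m t)%:R `^ (1 / 2 + tau).

(** The sums run over alarms, not over time: a quiet round changes nothing, and the k-th alarm adds
    the k-th term to both sums. *)
Lemma fado_potential t :
  norm2 (w t - wbar) ^+ 2
    + mu * \sum_(k < m t) k.+1%:R `^ (- (1 / 2 + tau)) <=
  norm2 wbar ^+ 2 + \sum_(k < m t) k.+1%:R `^ (- (1 + 2 * tau)).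
Proof.
elim: t => [|t IHt].
  by rewrite /fado_m big_geq// !big_ord0 mulr0 !addr0 /= add0r norm2N.
have mS := fado_mS t.
have [alarm|quiet] := boolP (fado_d eps gamma y t.+1); last first.
  by rewrite mS (negbTE quiet) addn0 /=; rewrite /fado_d in quiet;
     rewrite (negbTE quiet).
move: mS; rewrite alarm addn1 => mS.
have gE : gamma t.+1 = (m t).+1%:R `^ (- (1 / 2 + tau)).
  by rewrite gammaE ?mS// div1r powRN.
rewrite mS !big_ord_recr /= mulrDr.
have far := alarm; rewrite /fado_d /= in far; rewrite far.
have g_ge0 : 0 <= gamma t.+1 by rewrite gE powR_ge0.
have := fado_step_le _ _ _ _ _ _ eps_gt0 mu_gt0 g_ge0 (near _ (ltn0Sn t)) far.
have -> : (m t).+1%:R `^ (- (1 + 2 * tau)) = gamma t.+1 ^+ 2.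
  rewrite gE expr2 -powRD; last by rewrite pnatr_eq0 implybT.
  by congr (_ `^ _); field.
rewrite -gE; lra.
Qed.

Lemma fado_m_le t : 0 < tau -> tau < 1 / 2 ->
  mu * (m t)%:R `^ (1 / 2 - tau) <= norm2 wbar ^+ 2 + (1 + (2 * tau)^-1).
Proof.
move=> tau_gt0 tau_lt.
(* With no alarm the power of 0 is 0, because [1/2 - tau] is nonzero; [sum_powR_ge] covers only a
   positive count. *)
have [->|m_gt0] := posnP (m t).
  rewrite powR0 ?mulr0; last by lra.
  have := sqr_ge0 (norm2 wbar).
  have : 0 < (2 * tau)^-1 by rewrite invr_gt0; lra.
  lra.
have := fado_potential t.
have := sum_powR_le (2 * tau) (m t) (ltac:(lra)).
have := sum_powR_ge (1 / 2 + tau) (m t) (ltac:(lra)) m_gt0.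
rewrite [1 - _](_ : _ = 1 / 2 - tau); last by field.
move=> /(ler_wpM2l (ltW mu_gt0)).
have := sqr_ge0 (norm2 (w t - wbar)).
lra.
Qed.

End Fado.

(* The constant C hidden in the O depends only on tau (i.e. on the step sizes)
   and on a positive lower bound r of the norm of a nonzero wbar; it is uniform
   in n, eps, mu, wbar, the transactions, the run and the time t. The step-size
   formula is imposed at the times where it makes sense, i.e. once m_t >= 1. *)
Theorem theorem1 (R : realType) (tau : R) (tau_gt0 : 0 < tau)
    (tau_lt : tau < 1 / 2) (r : R) (r_gt0 : 0 < r) :
  exists C : R, 0 < C /\
  forall (n : nat) (eps mu : R) (wbar : 'rV[R]_n) (y : nat -> 'rV[R]_n)
      (gamma : nat -> R),
    0 < eps -> 0 < mu ->
    (forall t : nat, (0 < t)%N -> norm2 (y t - wbar) <= eps - mu) ->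
    (forall t : nat, (0 < t)%N -> (0 < fado_m eps gamma y t)%N ->
       gamma t = 1 / (fado_m eps gamma y t)%:R `^ (1 / 2 + tau)) ->
    wbar = 0 \/ r <= norm2 wbar ->
    forall t : nat, (0 < t)%N ->
      (fado_m eps gamma y t)%:R <=
        C * (norm2 wbar ^+ 2 / mu) `^ (2 / (1 - 2 * tau)).
Proof.
set S : R := 1 + (2 * tau)^-1.
have S_gt0 : 0 < S.
  have : 0 < (2 * tau)^-1 by rewrite invr_gt0; lra.
  by rewrite /S; lra.
(* Chosen so that [W + S <= K * W] as soon as [r^2 <= W], with [W] the squared norm of [wbar]. *)
set K : R := 1 + S / r ^+ 2.
have K_gt0 : 0 < K by rewrite addr_gt0// divr_gt0// exprn_gt0.
exists (K `^ (2 / (1 - 2 * tau))); split; first exact: powR_gt0.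
move=> n eps mu wbar y gamma eps_gt0 mu_gt0 near gammaE wbarP t _.
case: wbarP => [wbar0|r_le].
  rewrite (fado_m_center0 _ _ _ _ _ mu_gt0 near)//.
  by rewrite mulr_ge0 ?powR_ge0.
have := fado_m_le _ _ _ _ _ _ eps_gt0 mu_gt0 near gammaE t tau_gt0 tau_lt.
set m := fado_m _ _ _ _; set W := norm2 wbar ^+ 2 => mle.
have rW : r ^+ 2 <= W by rewrite ler_pXn2r ?nnegrE ?norm2_ge0// ltW.
have W_ge0 : 0 <= W by rewrite sqr_ge0.
have SW : S <= S / r ^+ 2 * W.
  by rewrite -mulrA ler_peMr ?(ltW S_gt0)// mulrC ler_pdivlMr ?mul1r ?exprn_gt0.
have {mle} mle : m%:R `^ (1 / 2 - tau) <= K * (W / mu).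
  rewrite mulrA ler_pdivlMr// [leLHS]mulrC /K mulrDl [1 * W]mul1r.
  by apply: le_trans mle _; rewrite lerD2l.
rewrite -powRM ?(ltW K_gt0) ?divr_ge0 ?(ltW mu_gt0)//.
(* The exponents [1/2 - tau] and [2 / (1 - 2 tau)] are reciprocal, so this power isolates [m]. *)
have -> : m%:R = (m%:R `^ (1 / 2 - tau)) `^ (2 / (1 - 2 * tau)) :> R.
  rewrite -powRrM [_ * _](_ : _ = 1) ?powRr1 ?ler0n//.
  by field; lra.
apply: ge0_ler_powR => //; rewrite ?nnegrE ?powR_ge0//.
- by rewrite divr_ge0; lra.
- by rewrite mulr_ge0 ?divr_ge0// ltW.
Qed.
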